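(* The Carlitz polynomials $\{G_j\}_{j\ge0}$ form an orthonormal basis of $C(O,K)$ if and only if the digit derivatives $\{D_j\}_{j\ge0}$ form an orthonormal basis of $C(O,K)$.
   Context: Let $q$ be a prime power, $K=\mathbf{F}_q((T))$, $O=\mathbf{F}_q[[T]]$, with absolute value $|x|=q^{-v(x)}$ where $v$ is the $T$-adic valuation. $C(O,K)$ is the $K$-Banach space of continuous functions $O\to K$ with sup-norm $\|f\|=\max_{t\in O}|f(t)|$. A sequence $(f_n)_{n\ge0}$ in $C(O,K)$ is an orthonormal basis if every $f$ can be written uniquely as $f=\sum a_nf_n$ with $a_n\in K$, $a_n\to0$, and then $\|f\|=\max|a_n|$. For $n\ge1$ put $[n]=T^{q^n}-T$, $F_0=1$, $F_n=[n][n-1]^q\cdots[1]^{q^{n-1}}$, $e_n(x)=\prod_{m\in\mathbf{F}_q[T],\deg m<n}(x-m)$ (including $m=0$); $E_0(x)=x$, $E_n(x)=e_n(x)/F_n$ for $n\ge1$. Hasse derivatives: $\mathcal{D}_n(\sum_ia_iT^i)=\sum_i\binom{i}{n}a_iT^{i-n}$ (binomials read in $\mathbf{F}_q$). For $j\ge0$ with base-$q$ expansion $j=\alpha_0+\alpha_1q+\cdots+\alpha_sq^s$ ($0\le\alpha_i<q$), set $G_j(x)=\prod_{n=0}^sE_n(x)^{\alpha_n}$ and $D_j(x)=\prod_{n=0}^s\mathcal{D}_n(x)^{\alpha_n}$, with $G_0=D_0=1$. (The paper also writes $\mathcal{D}_j$ for the digit derivative $D_j$.) *)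

(* Defs.v *)
(* K = F_q((T)) is modelled as Laurent series with
   coefficients in a finite field F (q = #|F|), absolute values are
   rational numbers q^(-v(x)). *)
From Stdlib Require Import ClassicalEpsilon.
From HB Require Import structures.
From mathcomp Require Import all_boot all_order all_algebra.
Set Implicit Arguments. Unset Strict Implicit. Unset Printing Implicit Defensive.
Import Order.TTheory GRing.Theory Num.Theory.
Local Open Scope ring_scope.

Section Laurent.
Variable F : finFieldType.

Definition qF : nat := #|F|.

Record laurent := Laurent {
  lcoef : int -> F ;
  lcoef_bounded : exists N : int, forall i : int, i < N -> lcoef i = 0 }.

Definition lbound (x : laurent) : int :=
  proj1_sig (constructive_indefinite_description _ (lcoef_bounded x)).

Lemma kzero_bd : exists N : int, forall i : int, i < N -> (fun _ : int => (0 : F)) i = 0.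
Proof. by exists 0. Qed.
Definition kzero : laurent := Laurent kzero_bd.

Lemma kmono_bd (k : int) :
  exists N : int, forall i : int, i < N -> (fun i => if i == k then (1 : F) else 0) i = 0.
Proof. by exists k => i hi /=; rewrite lt_eqF. Qed.
Definition kmono (k : int) : laurent := Laurent (kmono_bd k).

Definition kone : laurent := kmono 0.

Lemma kconst_bd (c : F) :
  exists N : int, forall i : int, i < N -> (fun i => if i == 0 then c else 0) i = 0.
Proof. by exists 0 => i hi /=; rewrite lt_eqF. Qed.
Definition kconst (c : F) : laurent := Laurent (kconst_bd c).

Lemma kadd_bd (x y : laurent) :
  exists N : int, forall i : int, i < N -> (fun i => lcoef x i + lcoef y i) i = 0.
Proof.
case: (lcoef_bounded x) => Nx Hx; case: (lcoef_bounded y) => Ny Hy.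
exists (Num.min Nx Ny) => i; rewrite lt_min => /andP[h1 h2] /=.
by rewrite Hx // Hy // addr0.
Qed.
Definition kadd (x y : laurent) : laurent := Laurent (kadd_bd x y).

Lemma kopp_bd (x : laurent) :
  exists N : int, forall i : int, i < N -> (fun i => - lcoef x i) i = 0.
Proof.
case: (lcoef_bounded x) => Nx Hx; exists Nx => i hi /=; by rewrite Hx // oppr0.
Qed.
Definition kopp (x : laurent) : laurent := Laurent (kopp_bd x).

Definition ksub (x y : laurent) : laurent := kadd x (kopp y).

Definition kmul_len (x y : laurent) (n : int) : nat :=
  (absz (n - (lbound x + lbound y))%R).+1.

Definition kmul_coef (x y : laurent) (n : int) : F :=
  if lbound x + lbound y <= n then
    \sum_(k < kmul_len x y n)
       lcoef x (lbound x + k%:Z) * lcoef y (n - lbound x - k%:Z)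
  else 0.

Lemma kmul_bd (x y : laurent) :
  exists N : int, forall i : int, i < N -> kmul_coef x y i = 0.
Proof.
exists (lbound x + lbound y) => i hi; rewrite /kmul_coef.
by rewrite leNgt hi.
Qed.
Definition kmul (x y : laurent) : laurent := Laurent (kmul_bd x y).

Definition kexp (x : laurent) (k : nat) : laurent := iter k (kmul x) kone.

(** division, used only with a nonzero denominator: the y with b * y = a *)
Definition kdiv (a b : laurent) : laurent :=
  epsilon (inhabits kzero) (fun y => kmul b y = a).

Definition knorm (x : laurent) : rat :=
  epsilon (inhabits 0) (fun r =>
    (x = kzero /\ r = 0) \/
    exists i : int, lcoef x i != 0 /\ (forall j : int, j < i -> lcoef x j = 0)
                    /\ r = (qF%:R : rat) ^ (- i)).

Definition O := {x : laurent | forall i : int, i < 0 -> lcoef x i = 0}.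

Definition kpoly (n : nat) (c : {ffun 'I_n -> F}) : laurent :=
  \big[kadd/kzero]_(k < n) kmul (kconst (c k)) (kmono k%:Z).

Definition e_car (n : nat) (x : laurent) : laurent :=
  \big[kmul/kone]_(c : {ffun 'I_n -> F}) ksub x (kpoly c).

Definition bracket (i : nat) : laurent := ksub (kmono (qF ^ i)%:Z) (kmono 1).

Definition F_car (n : nat) : laurent :=
  \big[kmul/kone]_(i < n) kexp (bracket i.+1) (qF ^ (n - i.+1)).

Definition E_car (n : nat) (x : laurent) : laurent :=
  if n is 0 then x else kdiv (e_car n x) (F_car n).

(** Hasse derivative D_n (sum a_i T^i) = sum binom(i,n) a_i T^(i-n);
    coefficient of T^j is binom(j+n, n) a_(j+n)  (only used on O). *)
Definition hasse_coef (n : nat) (x : laurent) (j : int) : F :=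
  (if 0 <= j + n%:Z then ('C(absz (j + n%:Z), n))%:R else 0) * lcoef x (j + n%:Z).

Lemma hasse_bd (n : nat) (x : laurent) :
  exists N : int, forall i : int, i < N -> hasse_coef n x i = 0.
Proof.
case: (lcoef_bounded x) => Nx Hx; exists (Nx - n%:Z) => i hi.
rewrite /hasse_coef Hx ?mulr0 //.
by rewrite -ltrBrDr.
Qed.
Definition hasse (n : nat) (x : laurent) : laurent := Laurent (hasse_bd n x).

Definition digit (j n : nat) : nat := (j %/ qF ^ n) %% qF.

(** Carlitz polynomials G_j(x) = prod_n E_n(x)^(alpha_n)  (factors with
    n > j have alpha_n = 0, so the product over n <= j is the full one) *)
Definition Gcar (j : nat) (t : O) : laurent :=
  \big[kmul/kone]_(n < j.+1) kexp (E_car n (proj1_sig t)) (digit j n).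

Definition Dder (j : nat) (t : O) : laurent :=
  \big[kmul/kone]_(n < j.+1) kexp (hasse n (proj1_sig t)) (digit j n).

Definition kcont (f : O -> laurent) : Prop :=
  forall (t : O) (eps : rat), 0 < eps -> exists del : rat, 0 < del /\
    forall s : O, knorm (ksub (proj1_sig s) (proj1_sig t)) < del ->
                  knorm (ksub (f s) (f t)) < eps.

Definition knull (a : nat -> laurent) : Prop :=
  forall eps : rat, 0 < eps -> exists N : nat, forall n, (N <= n)%N -> knorm (a n) < eps.

(** f = sum_n a_n f_n in C(O,K) (sup-norm = uniform convergence) *)
Definition kseries_to (a : nat -> laurent) (fs : nat -> O -> laurent) (f : O -> laurent) : Prop :=
  forall eps : rat, 0 < eps -> exists N : nat, forall M, (N <= M)%N -> forall t : O,
    knorm (ksub (f t) (\big[kadd/kzero]_(n < M) kmul (a n) (fs n t))) < eps.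

Definition maxval (S : rat -> Prop) : rat :=
  epsilon (inhabits 0) (fun m => S m /\ forall r, S r -> r <= m).

Definition supnorm (f : O -> laurent) : rat := maxval (fun r => exists t, r = knorm (f t)).

Definition is_onb (fs : nat -> O -> laurent) : Prop :=
  (forall n, kcont (fs n)) /\
  forall f, kcont f ->
    exists a : nat -> laurent,
      (knull a /\ kseries_to a fs f) /\
      (forall b : nat -> laurent, knull b -> kseries_to b fs f -> b = a) /\
      supnorm f = maxval (fun r => exists n, r = knorm (a n)).

End Laurent.

(* Main.v *)
Require Import Defs.
From HB Require Import structures.
From mathcomp Require Import all_boot all_order all_algebra.
From mathcomp Require Import fingroup cyclic finfield boolp zify ring.
Set Implicit Arguments. Unset Strict Implicit. Unset Printing Implicit Defensive.
Import Order.TTheory GRing.Theory Num.Theory.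
Local Open Scope ring_scope.

(** Grouping the factors of [e_(n+1)(a + T y)] by the constant term [c] of [m],
    the block [c = a] is [T^(q^n) e_n(y)] and, by Wilson's theorem,
    the other blocks multiply to [-1] modulo [T]. Hence [e_n(x)] is [T^v] times an
    integral element congruent to [(-1)^n a_n], where [a_n] is the [n]-th
    coefficient of [x] and [v] the valuation of [F_n]; as [F_n] is [T^v] times an
    element congruent to [(-1)^n], both [E_n(x)] and the Hasse derivative
    [D_n(x)] reduce to [a_n] modulo [T]. So [G_j] and [D_j] are integral-valued and
    congruent modulo [T], and being an orthonormal basis is invariant under such
    a perturbation: isometry on finite combinations and density of finite
    combinations both transfer by successive approximation. *)

(** * Finite sums over windows containing a support *)

Section Windows.
Variables (V : zmodType) (G : int -> V).

Definition supported_in (A : int) (L : nat) : Prop :=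
  (forall i, i < A -> G i = 0) /\ (forall i, A + L%:Z <= i -> G i = 0).

Lemma sum_window_widen (A : int) (L e : nat) : supported_in A L ->
  \sum_(k < L + e) G (A + k%:Z) = \sum_(k < L) G (A + k%:Z).
Proof.
move=> [_ hr]; rewrite big_split_ord /= [X in _ + X]big1 ?addr0 // => k _.
by apply: hr; rewrite /=; lia.
Qed.

(** Both sums agree with the sum over one larger window. This frees the product of series from the
    arbitrary bound [lbound] used in its definition. *)
Lemma sum_window (A B : int) (L M : nat) :
  supported_in A L -> supported_in B M ->
  \sum_(k < L) G (A + k%:Z) = \sum_(k < M) G (B + k%:Z).
Proof.
wlog le_AB : A B L M / A <= B.
  move=> IH hA hB; case: (lerP A B) => [|/ltW] h; first exact: IH.
  by rewrite (IH B A M L).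
move=> hA hB.
have [d eB] : exists d : nat, B = A + d%:Z by exists `|B - A|%N; lia.
have hAM : supported_in A (d + M).
  by case: hA hB => hA _ [_ hB]; split=> // i hi; apply: hB; lia.
rewrite -(sum_window_widen (d + M) hA) addnC (sum_window_widen L hAM).
rewrite big_split_ord /= big1 ?add0r => [|k _]; last first.
  by case: hB => hB _; apply: hB => /=; case: k => k /= hk; lia.
by apply: eq_bigr => k _; congr G; rewrite /=; lia.
Qed.

End Windows.

(** * The commutative ring of Laurent series *)

Section LaurentRing.
Variable F : finFieldType.
Local Notation K := (laurent F).
Implicit Types (x y z : K) (N A B : int).

(** Valuation at least [N], phrased so that 0 satisfies it for every [N] and needs no separate
    case. *)
Definition vge x N : Prop := forall i : int, i < N -> lcoef x i = 0.

Lemma laurentP x y : (forall i, lcoef x i = lcoef y i) -> x = y.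
Proof.
case: x y => [x hx] [y hy] /= e; have exy : x = y by apply: funext.
by subst y; congr Laurent; apply: Prop_irrelevance.
Qed.

Lemma vge_ex x : exists N, vge x N.
Proof. exact: lcoef_bounded. Qed.

Lemma vge_le N x A : A <= N -> vge x N -> vge x A.
Proof. by move=> h hx i hi; apply: hx; lia. Qed.

Lemma vge_lbound x : vge x (lbound x).
Proof. by rewrite /lbound; case: ClassicalEpsilon.constructive_indefinite_description. Qed.

Lemma lcoef_kmul x y A B (n : nat) : vge x A -> vge y B ->
  lcoef (kmul x y) (A + B + n%:Z) =
  \sum_(k < n.+1) lcoef x (A + k%:Z) * lcoef y (B + (n - k)%N%:Z).
Proof.
move=> hx hy; set m := _ + n%:Z.
pose G i := lcoef x i * lcoef y (m - i).
have GA : supported_in G A n.+1.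
  split=> i hi; rewrite /G; first by rewrite hx ?mul0r.
  by rewrite hy ?mulr0 //; lia.
transitivity (\sum_(k < n.+1) G (A + k%:Z)); last first.
  by apply: eq_bigr => k _; rewrite /G; congr (_ * lcoef y _); case: k => k /= hk; lia.
rewrite /= /kmul_coef; case: ifP => h.
  transitivity (\sum_(k < kmul_len x y m) G (lbound x + k%:Z)).
    by apply: eq_bigr => k _; rewrite /G; congr (_ * lcoef y _); lia.
  apply: sum_window GA; split=> i hi; rewrite /G.
    by rewrite vge_lbound ?mul0r.
  by rewrite (@vge_lbound y) ?mulr0 //; move: hi; rewrite /kmul_len; lia.
(* Here the definition returns 0. The two indices in each product add up to [m], which is less than
   [lbound x + lbound y], so one factor lies below its bound. *)
rewrite big1 // => k _; rewrite /G.
case: (ltP (A + k%:Z) (lbound x)) => hk; first by rewrite vge_lbound ?mul0r.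
by rewrite (@vge_lbound y) ?mulr0 //; lia.
Qed.

Lemma vge_kmul x y A B : vge x A -> vge y B -> vge (kmul x y) (A + B).
Proof.
move=> hx hy m hm; rewrite /= /kmul_coef; case: ifP => // h.
rewrite big1 // => k _; set i := _ + k%:Z.
case: (ltP i A) => hi; first by rewrite hx ?mul0r.
by rewrite hy ?mulr0 //; move: hi; rewrite /i; lia.
Qed.

Definition ltrunc A (n : nat) x : {poly F} := \poly_(k < n) lcoef x (A + k%:Z).

(** The first [n] coefficients of a product depend only on the first [n] coefficients of each
    factor. The ring laws for series are thereby inherited from polynomials. *)
Lemma lcoef_kmul_trunc x y A B (n k : nat) : vge x A -> vge y B -> (k < n)%N ->
  lcoef (kmul x y) (A + B + k%:Z) = (ltrunc A n x * ltrunc B n y)`_k.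
Proof.
move=> hx hy hk; rewrite (lcoef_kmul _ hx hy) coefM; apply: eq_bigr => j _.
by case: j => j /= hj; rewrite !coef_poly !ifT //; lia.
Qed.

Lemma ltrunc_kmul x y A B (n : nat) : vge x A -> vge y B ->
  ltrunc (A + B) n (kmul x y) = take_poly n (ltrunc A n x * ltrunc B n y).
Proof.
move=> hx hy; apply/polyP => k; rewrite coef_take_poly coef_poly.
by case: ifP => // hk; rewrite (lcoef_kmul_trunc hx hy hk).
Qed.

Lemma coef_mul_take (p r : {poly F}) (n k : nat) : (k < n)%N ->
  (p * take_poly n r)`_k = (p * r)`_k.
Proof.
move=> hk; rewrite !coefM; apply: eq_bigr => j _.
by case: j => j /= hj; rewrite coef_take_poly ifT //; lia.
Qed.

Lemma int_shift N i : N <= i -> exists k : nat, i = N + k%:Z.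
Proof. by move=> h; exists `|i - N|%N; lia. Qed.

Lemma kmulC : commutative (@kmul F).
Proof.
move=> x y; case: (vge_ex x) (vge_ex y) => [A hx] [B hy]; apply: laurentP => i.
case: (ltP i (A + B)) => [hi|/int_shift[k ->]].
  by rewrite (vge_kmul hx hy) // (vge_kmul hy hx) // addrC.
by rewrite (lcoef_kmul_trunc hx hy (ltnSn k)) mulrC [A + B]addrC
  (lcoef_kmul_trunc hy hx (ltnSn k)).
Qed.

Lemma kmulA : associative (@kmul F).
Proof.
move=> x y z; case: (vge_ex x) (vge_ex y) (vge_ex z) => [A hx] [B hy] [C hz].
have hxy := vge_kmul hx hy; have hyz := vge_kmul hy hz.
apply: laurentP => i; case: (ltP i (A + B + C)) => [hi|/int_shift[k ->]].
  by rewrite (vge_kmul hxy hz) // (vge_kmul hx hyz) // addrA.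
rewrite (lcoef_kmul_trunc hxy hz (ltnSn k)) -[A + B + C]addrA.
rewrite (lcoef_kmul_trunc hx hyz (ltnSn k)) !ltrunc_kmul // coef_mul_take //.
by rewrite [take_poly _ _ * _]mulrC coef_mul_take // mulrA [in RHS]mulrC.
Qed.

Lemma vge_kone : vge (kone F) 0.
Proof. by move=> i hi; rewrite /= lt_eqF. Qed.

Lemma kmul1x : left_id (kone F) (@kmul F).
Proof.
move=> x; case: (vge_ex x) => [A hx]; apply: laurentP => i.
case: (ltP i A) => [hi|/int_shift[k ->]].
  by rewrite (vge_kmul vge_kone hx) ?add0r // hx.
rewrite -{1}[A]add0r (lcoef_kmul_trunc vge_kone hx (ltnSn k)).
have -> : ltrunc 0 k.+1 (kone F) = 1.
  by apply/polyP => j; rewrite coef_poly coef1 /= add0r; case: j => [|j] //=; rewrite if_same.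
by rewrite mul1r coef_poly ltnSn.
Qed.

Lemma vge_kadd x y N : vge x N -> vge y N -> vge (kadd x y) N.
Proof. by move=> hx hy i hi; rewrite /= hx // hy // addr0. Qed.

Lemma kmulDl : left_distributive (@kmul F) (@kadd F).
Proof.
move=> x y z; case: (vge_ex x) (vge_ex y) (vge_ex z) => [A hx] [B hy] [C hz].
have {}hx : vge x (Num.min A B) by apply: vge_le hx; lia.
have {}hy : vge y (Num.min A B) by apply: vge_le hy; lia.
have hxy := vge_kadd hx hy; move: (Num.min A B) => {A B} A in hx hy hxy *.
apply: laurentP => i; case: (ltP i (A + C)) => [hi|/int_shift[k ->]].
  by rewrite (vge_kmul hxy hz) // (vge_kadd (vge_kmul hx hz) (vge_kmul hy hz)).
rewrite (lcoef_kmul_trunc hxy hz (ltnSn k)).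
rewrite -[RHS]/(lcoef (kmul x z) _ + lcoef (kmul y z) _).
rewrite (lcoef_kmul_trunc hx hz (ltnSn k)) (lcoef_kmul_trunc hy hz (ltnSn k)).
rewrite -coefD -mulrDl; congr (polyseq (_ * _))`_k.
by apply/polyP => j; rewrite coefD !coef_poly /=; case: ifP; rewrite ?addr0.
Qed.

Lemma kaddA : associative (@kadd F).
Proof. by move=> x y z; apply: laurentP => i /=; rewrite addrA. Qed.
Lemma kaddC : commutative (@kadd F).
Proof. by move=> x y; apply: laurentP => i /=; rewrite addrC. Qed.
Lemma kadd0x : left_id (kzero F) (@kadd F).
Proof. by move=> x; apply: laurentP => i /=; rewrite add0r. Qed.
Lemma kaddNx : left_inverse (kzero F) (@kopp F) (@kadd F).
Proof. by move=> x; apply: laurentP => i /=; rewrite addNr. Qed.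

HB.instance Definition _ := gen_eqMixin K.
HB.instance Definition _ := gen_choiceMixin K.
HB.instance Definition _ := GRing.isZmodule.Build K kaddA kaddC kadd0x kaddNx.

Lemma kone_neq0 : kone F != 0.
Proof.
apply/eqP => /(congr1 (fun x => lcoef x 0)) /= /eqP.
by rewrite (oner_eq0 F).
Qed.

HB.instance Definition _ :=
  GRing.Zmodule_isComNzRing.Build K kmulA kmulC kmul1x kmulDl kone_neq0.

Lemma kE : (kzero F = 0) * (kone F = 1) * (@kadd F = +%R) * (@kmul F = *%R)
  * (forall x y, ksub x y = x - y) * (forall x n, kexp x n = x ^+ n).
Proof.
do !split=> //.
by move=> x n; rewrite /kexp -[kone F]/(1 : K); elim: n => //= n ->; rewrite exprS.
Qed.

(** * The valuation filtration, monomials, completeness and residues modulo [T] *)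

Lemma lcoefN x i : lcoef (- x) i = - lcoef x i. Proof. by []. Qed.
Lemma lcoefB x y i : lcoef (x - y) i = lcoef x i - lcoef y i. Proof. by []. Qed.
Lemma lcoef1 i : lcoef (1 : K) i = (i == 0)%:R.
Proof. by rewrite -[1]/(kone F) /=; case: eqP. Qed.

Lemma vge1 : vge (1 : K) 0. Proof. exact: vge_kone. Qed.
Lemma vgeD x y N : vge x N -> vge y N -> vge (x + y) N. Proof. exact: vge_kadd. Qed.
Lemma vgeN x N : vge x N -> vge (- x) N.
Proof. by move=> hx i hi; rewrite lcoefN hx ?oppr0. Qed.
Lemma vgeB x y N : vge x N -> vge y N -> vge (x - y) N.
Proof. by move=> hx hy; apply: vgeD (vgeN _). Qed.
Lemma vgeBC x y N : vge (x - y) N -> vge (y - x) N.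
Proof. by move=> h; rewrite -opprB; apply: vgeN. Qed.
Lemma vgeM x y A B : vge x A -> vge y B -> vge (x * y) (A + B).
Proof. exact: vge_kmul. Qed.
Lemma vgeMl x y N : vge x N -> vge y 0 -> vge (x * y) N.
Proof. by move=> hx hy; rewrite -[N]addr0; apply: vgeM. Qed.
Lemma vgeMr x y N : vge x 0 -> vge y N -> vge (x * y) N.
Proof. by move=> hx hy; rewrite -[N]add0r; apply: vgeM. Qed.
Lemma vge_sum (I : Type) (r : seq I) (P : pred I) (f : I -> K) N :
  (forall i, P i -> vge (f i) N) -> vge (\sum_(i <- r | P i) f i) N.
Proof. by move=> h; apply: (big_ind (vge^~ N)) => // x y; apply: vgeD. Qed.
Lemma vgeX x N (n : nat) : vge x N -> vge (x ^+ n) (N *+ n).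
Proof.
move=> hx; elim: n => [|n IH]; first exact: vge1.
by rewrite exprS mulrS; apply: vgeM.
Qed.

Lemma vge_all0 x : (forall n : nat, vge x n%:Z) -> x = 0.
Proof. by move=> h; apply: laurentP => i; apply: (h `|i|.+1); lia. Qed.

Lemma vge_kmono k : vge (kmono F k) k.
Proof. by move=> i hi; rewrite /= lt_eqF. Qed.

Lemma vge_kconst c : vge (kconst c : K) 0.
Proof. by move=> i hi; rewrite /= lt_eqF. Qed.

Lemma lcoefM_lead x y A B : vge x A -> vge y B ->
  lcoef (x * y) (A + B) = lcoef x A * lcoef y B.
Proof.
move=> hx hy; rewrite -[A + B]addr0 (lcoef_kmul 0 hx hy) big_ord1.
by rewrite !addr0.
Qed.

Lemma lcoef_mulmono k x i : lcoef (kmono F k * x) (k + i) = lcoef x i.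
Proof.
case: (vge_ex x) => A hx; case: (ltP i A) => [hi|/int_shift[n ->]].
  by rewrite (vgeM (@vge_kmono k) hx) ?hx //; lia.
rewrite addrA (lcoef_kmul n (@vge_kmono k) hx) big_ord_recl big1 => [|j _].
  by rewrite addr0 subn0 /= addr0 eqxx mul1r.
by rewrite /= [_ == k]negbTE ?mul0r // /bump; lia.
Qed.

Lemma kmonoD j k : kmono F (j + k) = kmono F j * kmono F k.
Proof.
apply: laurentP => i; have -> : i = j + (i - j) by lia.
by rewrite lcoef_mulmono /=; congr (if _ then _ else _); lia.
Qed.

Lemma kmono0 : kmono F 0 = 1. Proof. by []. Qed.

Lemma kmonoX k (n : nat) : kmono F k ^+ n = kmono F (k *+ n).
Proof. by elim: n => // n IH; rewrite exprS IH -kmonoD mulrS. Qed.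

Lemma kmonoNK k : kmono F k * kmono F (- k) = 1.
Proof. by rewrite -kmonoD subrr. Qed.

(** Completeness of [K]. The coefficient of index [i >= 0] is stationary from [b i.+1] on, and those
    of negative index from [b 0] on, so the limit is read off there. *)
Lemma laurent_lim (b : nat -> K) :
  (forall m n : nat, (m <= n)%N -> vge (b n - b m) m%:Z) ->
  exists a : K, forall n : nat, vge (a - b n) n%:Z.
Proof.
move=> hb; pose c (i : int) := lcoef (b (if i is Posz n then n.+1 else 0%N)) i.
have hc n i : i < n%:Z -> c i = lcoef (b n) i.
  rewrite /c => hi; case: i hi => [i|i] hi; apply/esym/eqP; rewrite -subr_eq0 -lcoefB.
    by apply/eqP; apply: (hb i.+1 n); lia.
  by apply/eqP; apply: (hb 0%N n); lia.
have hbd : exists N : int, forall i, i < N -> c i = 0.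
  case: (vge_ex (b 0%N)) => N hN; exists (Num.min N 0) => i hi.
  by rewrite (hc 0%N) ?hN //; lia.
by exists (Laurent hbd) => n i hi; rewrite lcoefB /= (hc n) ?subrr.
Qed.

(* x = c mod T, for x in O *)
Definition res x (c : F) : Prop := vge x 0 /\ lcoef x 0 = c.

Lemma resP x c : res x c -> vge (x - kconst c) 1.
Proof.
case=> hx ec i hi; rewrite lcoefB; case: (ltP i 0) => h.
  by rewrite hx // vge_kconst ?subrr.
have -> : i = 0 by lia.
by rewrite ec /= subrr.
Qed.

Lemma res_vge1B x y c : res x c -> res y c -> vge (x - y) 1.
Proof.
move=> hx hy; have -> : x - y = (x - kconst c) - (y - kconst c) by ring.
by apply: vgeB; apply: resP.
Qed.

Lemma res1 : res 1 1. Proof. by split; [exact: vge1|rewrite lcoef1]. Qed.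
Lemma res_const c : res (kconst c) c. Proof. by split; [exact: vge_kconst|]. Qed.
Lemma resM x y c d : res x c -> res y d -> res (x * y) (c * d).
Proof.
move=> [hx <-] [hy <-]; split; first exact: vgeMl.
by rewrite -[in LHS](addr0 0) lcoefM_lead.
Qed.
Lemma resD x y c d : res x c -> res y d -> res (x + y) (c + d).
Proof. by move=> [hx <-] [hy <-]; split=> //; apply: vgeD. Qed.
Lemma resX x c n : res x c -> res (x ^+ n) (c ^+ n).
Proof. by move=> h; elim: n => [|n IH]; [exact: res1|rewrite !exprS; apply: resM]. Qed.
Lemma res_prod (I : Type) (r : seq I) (P : pred I) (f : I -> K) (g : I -> F) :
  (forall i, P i -> res (f i) (g i)) ->
  res (\prod_(i <- r | P i) f i) (\prod_(i <- r | P i) g i).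
Proof. by move=> h; apply: (big_ind2 res) => //; [exact: res1|move=> ? ? ? ?; apply: resM]. Qed.
Lemma res_vge1 x : vge x 1 -> res x 0.
Proof. by move=> h; split; [apply: vge_le h|apply: h]. Qed.

(** Geometric series: [c^-1 x = 1 - w] with [w] divisible by [T], and the sum of the powers of [w]
    converges to the inverse of [1 - w]. *)
Lemma res_inv x c : res x c -> c != 0 -> exists2 y, x * y = 1 & res y c^-1.
Proof.
move=> hx c0; pose w := 1 - kconst c^-1 * x.
have hw : vge w 1.
  apply: (@res_vge1B _ _ 1); first exact: res1.
  by rewrite -(mulVf c0); apply: resM hx; apply: res_const.
have hwn n : vge (w ^+ n) n%:Z by rewrite -natz; exact: vgeX.
have [a ha] : exists a, forall n, vge (a - \sum_(k < n) w ^+ k) n%:Z.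
  apply: laurent_lim => m n lemn; rewrite -(subnKC lemn) big_split_ord /=.
  rewrite [_ + \sum_(i < n - m) _]addrC addrK.
  by apply: vge_sum => k _; apply: vge_le (hwn _); lia.
have e : kconst c^-1 * x = 1 - w by rewrite /w opprB addrC subrK.
have ea : (1 - w) * a = 1.
  apply/eqP; rewrite -subr_eq0; apply/eqP; apply: vge_all0 => n.
  have -> : (1 - w) * a - 1 = (1 - w) * (a - \sum_(k < n) w ^+ k) - w ^+ n.
    rewrite mulrBr; have -> : (1 - w) * (\sum_(k < n) w ^+ k) = 1 - w ^+ n.
      by rewrite -[1 - w]opprB mulNr -subrX1 opprB.
    by ring.
  apply: vgeB => //; apply: vgeMr => //.
  by apply: vgeB; [exact: vge1|apply: vge_le hw].
exists (kconst c^-1 * a); first by rewrite mulrCA mulrA e.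
rewrite -[X in res _ X]mulr1; apply: resM; first exact: res_const.
split; first by have := ha 0%N; rewrite big_ord0 subr0.
have := ha 1%N; rewrite big_ord1 expr0 => h.
by have /eqP := h 0 isT; rewrite lcoefB lcoef1 subr_eq0 => /eqP.
Qed.

End LaurentRing.

(** * Carlitz polynomials and digit derivatives modulo [T] *)

Section Carlitz.
Variable F : finFieldType.
Local Notation K := (laurent F).
Implicit Types (x y z : K) (N A B : int).
Local Notation q := (qF F).
Local Notation T := (kmono F 1).

Lemma expf_qpow (c : F) (n : nat) : c ^+ (q ^ n) = c.
Proof. by elim: n => [|n IH]; rewrite ?expn0 // expnSr exprM IH expf_card. Qed.

(* Wilson's theorem, by differentiating X^q - X at a *)
Lemma prod_subf (a : F) : \prod_(c | c != a) (a - c) = -1.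
Proof.
have := congr1 (fun p : {poly F} => p^`().[a]) (finField_genPoly F).
rewrite (bigD1 a) //= derivB derivXn derivX derivM derivXsubC mul1r !hornerE.
rewrite subrr mul0r addr0 horner_prod hornerMn hornerXn.
(* The derivative of [X^q] vanishes because [q] is the order of the additive group of [F]. *)
have -> : a ^+ #|F|.-1 *+ #|F| = 0.
  rewrite -mulr_natr -cardsT -FinRing.zmodXgE.
  by rewrite (expg_cardG (G := [set: F]%G)) ?inE ?mulr0.
by rewrite add0r => ->; apply: eq_bigr => c _; rewrite !hornerE.
Qed.

Lemma kpoly_recl n (c : F) (f : {ffun 'I_n -> F}) (g : {ffun 'I_n.+1 -> F}) :
  g ord0 = c -> (forall i, g (lift ord0 i) = f i) ->
  kpoly g = kconst c + T * kpoly f.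
Proof.
move=> g0 gS; rewrite /kpoly !kE big_ord_recl g0 mulr1; congr (_ + _).
rewrite mulr_sumr; apply: eq_bigr => i _; rewrite gS mulrCA -kmonoD.
by congr (_ * kmono F _); rewrite /= /bump; lia.
Qed.

Lemma vge_kpoly n (c : {ffun 'I_n -> F}) : vge (kpoly c) 0.
Proof.
rewrite /kpoly !kE; apply: vge_sum => i _; apply: vgeMr; first exact: vge_kconst.
by apply: vge_le (@vge_kmono F _); lia.
Qed.

(** Coefficientwise form of [m = c + T m'], used to reindex the product [e_(n+1)] by constant
    terms. *)
Definition ffcons n (p : F * {ffun 'I_n -> F}) : {ffun 'I_n.+1 -> F} :=
  [ffun i => if unlift ord0 i is Some j then p.2 j else p.1].
Definition ffuncons n (f : {ffun 'I_n.+1 -> F}) : F * {ffun 'I_n -> F} :=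
  (f ord0, [ffun i => f (lift ord0 i)]).

Lemma ffcons_bij n : bijective (@ffcons n).
Proof.
exists (@ffuncons n) => [[c f]|f].
  rewrite /ffuncons ffunE unlift_none; congr pair.
  by apply/ffunP => i; rewrite !ffunE liftK.
apply/ffunP => i; rewrite ffunE; case: unliftP => [j ->|->] //=.
by rewrite ffunE.
Qed.

Lemma e_carE n x : e_car n x = \prod_(c : {ffun 'I_n -> F}) (x - kpoly c).
Proof. by []. Qed.

Lemma e_car0 x : e_car 0 x = x.
Proof.
rewrite e_carE (bigD1 [ffun=> 0]) //= big1 ?mulr1.
  by rewrite /kpoly !kE big_ord0 subr0.
by move=> c /eqP []; apply/ffunP => -[].
Qed.

Lemma e_car_recl n (a : F) y : vge y 0 ->
  exists2 u, res u (-1) &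
    e_car n.+1 (kconst a + T * y) = kmono F (q ^ n)%:Z * e_car n y * u.
Proof.
move=> hy.
(* The block of all [m] with constant term [c]. *)
pose P (c : F) := \prod_(f : {ffun 'I_n -> F}) (kconst (a - c) + T * (y - kpoly f)).
have -> : e_car n.+1 (kconst a + T * y) = \prod_c P c.
  rewrite e_carE (reindex _ (onW_bij _ (ffcons_bij n))) /=.
  rewrite /P pair_big /=; apply: eq_bigr => -[c f] _ /=.
  rewrite (@kpoly_recl n c f); first last.
  - by move=> i; rewrite ffunE liftK.
  - by rewrite ffunE unlift_none.
  have -> : kconst (a - c) = kconst a - kconst c.
    by apply: laurentP => i; rewrite lcoefB /=; case: ifP => _; rewrite ?subrr.
  by ring.
rewrite (bigD1 a) //=; exists (\prod_(c | c != a) P c).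
  rewrite -(prod_subf a); apply: res_prod => c _.
  (* The block has [q^n] factors, all congruent to [a - c], and [(a - c)^(q^n) = a - c] in [F]. *)
  rewrite -[a - c](expf_qpow _ n) /P.
  have -> : (q ^ n)%N = #|{ffun 'I_n -> F}| by rewrite card_ffun card_ord.
  rewrite -prodr_const; apply: res_prod => f _.
  rewrite -[a - c]addr0; apply: resD; first by rewrite addr0; apply: res_const.
  apply: res_vge1; apply: vgeMl; first exact: vge_kmono.
  by apply: vgeB => //; apply: vge_kpoly.
congr (_ * _); rewrite /P subrr.
have -> : kconst (0 : F) = 0 by apply: laurentP => i /=; rewrite if_same.
under eq_bigr do rewrite add0r.
rewrite big_split /= prodr_const -e_carE kmonoX card_ffun card_ord; congr (kmono F _ * _).
by rewrite -natz.
Qed.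

(* The T-adic valuation of F_n *)
Definition valF n : nat := \sum_(i < n) q ^ (n - i.+1).

(** Induction on [n] for all [x]: with [a_0] the constant term, [y = (x - a_0)/T] is integral and
    its [n]-th coefficient is the next one of [x]. Each step adds [q^n] to the valuation and a
    factor -1 to the residue. *)
Lemma e_car_lead n x : vge x 0 ->
  exists2 z, e_car n x = kmono F (valF n)%:Z * z & res z ((-1) ^+ n * lcoef x n%:Z).
Proof.
elim: n x => [|n IH] x hx.
  exists x; first by rewrite e_car0 /valF big_ord0 kmono0 mul1r.
  by rewrite expr0 mul1r; split.
pose y := kmono F (-1) * (x - kconst (lcoef x 0)).
have ex : x = kconst (lcoef x 0) + T * y.
  by rewrite /y mulrA kmonoNK mul1r addrC subrK.
have hy : vge y 0.
  by rewrite -[0]/(-1 + 1 : int); apply: vgeM; [exact: vge_kmono|apply: resP].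
have ey : lcoef y n%:Z = lcoef x n.+1%:Z.
  have -> : n%:Z = -1 + n.+1%:Z by lia.
  by rewrite lcoef_mulmono lcoefB /= subr0.
have [z ez hz] := IH y hy; have [u hu eu] := e_car_recl n (lcoef x 0) hy.
exists (z * u); last first.
  rewrite -ey exprSr.
  have -> : (-1) ^+ n * -1 * lcoef y n%:Z = (-1) ^+ n * lcoef y n%:Z * -1 by ring.
  exact: resM.
rewrite [in LHS]ex eu ez !mulrA -kmonoD; congr (kmono F _ * _ * _).
by rewrite -PoszD /valF [in RHS]big_ord_recl subn1.
Qed.

(** Each bracket is [T] times [T^(q^i - 1) - 1], which is congruent to -1. The exponents [q^(n-i)]
    leave this residue unchanged, as they act trivially on [F]. *)
Lemma F_car_lead n : exists2 u, F_car F n = kmono F (valF n)%:Z * u & res u ((-1) ^+ n).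
Proof.
pose u i := kmono F ((q ^ i.+1)%:Z - 1) - 1.
have eb i : bracket F i.+1 = T * u i.
  by rewrite /bracket kE /u mulrBr mulr1 -kmonoD; congr (kmono F _ - _); lia.
have q_gt1 : (1 < q)%N by exact: finNzRing_gt1.
have hu i : res (u i) (-1).
  rewrite -[-1]add0r; apply: resD; last first.
    by split; [apply/vgeN/vge1|rewrite lcoefN lcoef1].
  apply: res_vge1; apply: vge_le (@vge_kmono F _).
  have : (q ^ 1 < q ^ i.+2)%N by rewrite ltn_exp2l.
  have : (1 < q ^ i.+1)%N by rewrite -{1}[1%N](expn0 q) ltn_exp2l.
  lia.
exists (\prod_(i < n) u i ^+ (q ^ (n - i.+1))).
  rewrite /F_car !kE; under eq_bigr do rewrite kE eb exprMn.
  rewrite big_split /=; congr (_ * _).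
  under eq_bigr do rewrite kmonoX natz.
  rewrite /valF; elim/big_rec2: _ => [|i y1 y2 _ ->]; first by [].
  by rewrite -kmonoD PoszD.
have -> : (-1) ^+ n = \prod_(i < n) (-1 : F) ^+ (q ^ (n - i.+1)).
  by under eq_bigr do rewrite expf_qpow; rewrite prodr_const card_ord.
by apply: res_prod => i _; apply: resX.
Qed.

Lemma F_car_inv n : exists2 u, F_car F n * (kmono F (- (valF n)%:Z) * u) = 1 &
  res u ((-1) ^+ n).
Proof.
have [v ev hv] := F_car_lead n.
have [|w ew hw] := res_inv hv; first by rewrite signr_eq0.
exists w; last by move: hw; rewrite invr_sign.
by rewrite ev mulrACA kmonoNK ew mul1r.
Qed.

(** The inverse [z] of [y] provides a solution for [epsilon] to choose and also forces its value. *)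
Lemma kdiv_inv x y z : y * z = 1 -> kdiv x y = x * z.
Proof.
move=> h; have hd : y * kdiv x y = x.
  rewrite /kdiv; apply: (ClassicalEpsilon.epsilon_spec (inhabits (kzero F))
    (fun y' => kmul y y' = x)).
  by exists (z * x); rewrite kE mulrA h mul1r.
by rewrite -{2}hd mulrAC h mul1r.
Qed.

(** Numerator and denominator carry the same power of [T], and their signs [(-1)^n] cancel. *)
Lemma res_E_car n x : vge x 0 -> res (E_car n x) (lcoef x n%:Z).
Proof.
move=> hx; case: n => [|n] /=; first by split.
have [u eu hu] := F_car_inv n.+1; have [z ez hz] := e_car_lead n.+1 hx.
rewrite (kdiv_inv _ eu) ez mulrACA kmonoNK mul1r.
have <- : (-1) ^+ n.+1 * lcoef x n.+1%:Z * (-1) ^+ n.+1 = lcoef x n.+1%:Z.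
  by rewrite mulrAC -expr2 sqrr_sign mul1r.
exact: resM.
Qed.

(** At a negative exponent [i] the binomial has upper index below [n], or the guard returns 0; at
    exponent 0 it is [binom(n, n) = 1]. *)
Lemma res_hasse n x : vge x 0 -> res (hasse n x) (lcoef x n%:Z).
Proof.
move=> hx; split=> [i hi|]; rewrite /= /hasse_coef; last by rewrite add0r /= binn mul1r.
case: ifP => h; last by rewrite mul0r.
by rewrite bin_small ?mul0r //; lia.
Qed.

Lemma GcarE j (t : O F) : Gcar j t = \prod_(n < j.+1) E_car n (proj1_sig t) ^+ digit F j n.
Proof. by rewrite /Gcar !kE; under eq_bigr do rewrite kE. Qed.

Lemma DderE j (t : O F) : Dder j t = \prod_(n < j.+1) hasse n (proj1_sig t) ^+ digit F j n.
Proof. by rewrite /Dder !kE; under eq_bigr do rewrite kE. Qed.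

(** The common residue is the monomial in the coefficients of [t] whose exponents are the digits of
    [j]. *)
Lemma Gcar_Dder_res j (t : O F) : exists c, res (Gcar j t) c /\ res (Dder j t) c.
Proof.
exists (\prod_(n < j.+1) lcoef (proj1_sig t) n%:Z ^+ digit F j n).
rewrite GcarE DderE; case: t => t ht /=.
by split; apply: res_prod => n _; apply: resX; [apply: res_E_car|apply: res_hasse].
Qed.

End Carlitz.

(** * Translation of the absolute value and of limits into valuations *)

Section Analysis.
Variable F : finFieldType.
Local Notation K := (laurent F).
Implicit Types (x y z : K) (N A B : int).
Local Notation q := (qF F).
Local Notation Q := (q%:R : rat).

Lemma Q_gt1 : 1 < Q.
Proof. by rewrite ltr1n; exact: finNzRing_gt1. Qed.

Lemma Q_gt0 : 0 < Q. Proof. exact: lt_trans Q_gt1. Qed.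

Lemma leadP x : x = 0 \/ exists i, lcoef x i != 0 /\ vge x i.
Proof.
case: (vge_ex x) => A hx; case: (pselect (x = 0)) => [|x0]; [by left|right].
have [k hk] : exists k : nat, lcoef x (A + k%:Z) != 0.
  apply/not_existsP => h; apply: x0; apply: laurentP => i.
  case: (ltP i A) => [hi|/int_shift[k ->]]; first by rewrite hx.
  by have /negP := h k; rewrite negbK => /eqP.
have h : exists k : nat, lcoef x (A + k%:Z) != 0 by exists k.
exists (A + (ex_minn h)%:Z); case: ex_minnP => m hm mmin; split=> // i hi.
case: (ltP i A) => [hiA|/int_shift[j ej]]; first by rewrite hx.
rewrite ej in hi *; apply/eqP/negPn/negP => /mmin; lia.
Qed.

(** A nonzero series has a leading coefficient, so the specification given to [epsilon] is
    satisfiable and [knorm] is not a default value. *)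
Lemma knormP x : (x = 0 /\ knorm x = 0) \/
  exists i, [/\ lcoef x i != 0, vge x i & knorm x = Q ^ (- i)].
Proof.
have : exists r, (x = kzero F /\ r = 0) \/
    exists i : int, lcoef x i != 0 /\ (forall j : int, j < i -> lcoef x j = 0)
                    /\ r = Q ^ (- i).
  case: (leadP x) => [x0|[i [xi hx]]]; first by exists 0; left.
  by exists (Q ^ (- i)); right; exists i.
move/(ClassicalEpsilon.epsilon_spec (inhabits 0)); rewrite -/(knorm x).
case=> [|[i [xi [hx e]]]]; [by left|by right; exists i].
Qed.

(** The dictionary between norms and valuations, after which estimates concern integer exponents
    only. *)
Lemma knorm_le x N : knorm x <= Q ^ (- N) <-> vge x N.
Proof.
case: (knormP x) => [[-> ->]|[i [xi hx ->]]].
  by split=> // _; rewrite exprz_ge0 // ltW // Q_gt0.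
rewrite ler_eXz2l ?Q_gt1 //; split=> h; first by apply: vge_le hx; lia.
by rewrite lerN2 leNgt; apply/negP => hi; move: xi; rewrite h ?eqxx.
Qed.

Lemma Qpow_gt0 N : 0 < Q ^ N. Proof. by rewrite exprz_gt0 // Q_gt0. Qed.

Lemma small_Qpow (eps : rat) : 0 < eps -> exists n : nat, Q ^ (- n%:Z) < eps.
Proof.
move=> he; have hq n : (n%:R : rat) <= Q ^+ n.
  rewrite -natrX ler_nat; apply: ltnW; apply: ltn_expl.
  exact: finNzRing_gt1.
have [n hn] : exists n : nat, eps^-1 < n%:R.
  by exists (Num.bound eps^-1); apply: le_lt_trans (archi_boundP _) => //;
    rewrite invr_ge0 ltW.
exists n; rewrite -exprnN -[eps]invrK ltf_pV2 ?posrE ?invr_gt0 ?exprn_gt0 ?Q_gt0 //.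
exact: lt_le_trans hn (hq n).
Qed.

Lemma knorm_small (eps : rat) : 0 < eps ->
  exists n : nat, forall x, vge x n%:Z -> knorm x < eps.
Proof.
move=> /small_Qpow[n hn]; exists n => x /knorm_le h.
exact: le_lt_trans h hn.
Qed.

Lemma knorm_lt_vge x N : knorm x < Q ^ (- N) -> vge x N.
Proof. by move/ltW/knorm_le. Qed.

(** Radii are restricted to the powers [q^(-n)], which suffices because they tend to 0. *)
Definition vcont (f : O F -> K) : Prop :=
  forall t (n : nat), exists m : nat, forall s : O F,
    vge (proj1_sig s - proj1_sig t) m%:Z -> vge (f s - f t) n%:Z.

Lemma kcontP (f : O F -> K) : kcont f <-> vcont f.
Proof.
split=> h t.
  move=> n; have [d [d0 hd]] := h t _ (Qpow_gt0 (- n%:Z)).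
  have [m hm] := knorm_small d0.
  by exists m => s /hm /hd; rewrite kE => /knorm_lt_vge.
move=> eps /knorm_small[n hn]; have [m hm] := h t n.
exists (Q ^ (- m%:Z)); split=> [|s]; first exact: Qpow_gt0.
by rewrite !kE => /knorm_lt_vge /hm /hn.
Qed.

Definition vnull (a : nat -> K) : Prop :=
  forall n : nat, exists M : nat, forall k, (M <= k)%N -> vge (a k) n%:Z.

Lemma knullP (a : nat -> K) : knull a <-> vnull a.
Proof.
split=> h.
  move=> n; have [M hM] := h _ (Qpow_gt0 (- n%:Z)).
  by exists M => k /hM /knorm_lt_vge.
move=> eps /knorm_small[n hn]; have [M hM] := h n.
by exists M => k /hM /hn.
Qed.

Definition vseries (a : nat -> K) (fs : nat -> O F -> K) (f : O F -> K) : Prop :=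
  forall n : nat, exists N : nat, forall M, (N <= M)%N -> forall t,
    vge (f t - \sum_(k < M) a k * fs k t) n%:Z.

Lemma kseriesP a fs f : kseries_to a fs f <-> vseries a fs f.
Proof.
split=> h.
  move=> n; have [N hN] := h _ (Qpow_gt0 (- n%:Z)).
  by exists N => M /hN {}hN t; have := hN t; rewrite !kE => /knorm_lt_vge.
move=> eps /knorm_small[n hn]; have [N hN] := h n.
by exists N => M /hN {}hN t; rewrite !kE; apply/hn/hN.
Qed.

(* The absolute value is discrete, so every bounded family attains its
   supremum and [maxval] is not the junk value of [epsilon]. *)
Lemma maxval_knorm (I : Type) (i0 : I) (u : I -> K) (A : int) :
  (forall i, vge (u i) A) ->
  let m := maxval (fun r => exists i, r = knorm (u i)) in
  (exists i, m = knorm (u i)) /\ forall i, knorm (u i) <= m.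
Proof.
move=> hA m.
suff [i hi] : exists i, forall j, knorm (u j) <= knorm (u i).
  pose S r := exists i, r = knorm (u i).
  have : exists m, S m /\ forall r, S r -> r <= m.
    by exists (knorm (u i)); split; [exists i|move=> r [j ->]].
  move/(ClassicalEpsilon.epsilon_spec (inhabits 0)); rewrite -/(maxval S) -/m.
  by case=> h1 h2; split=> // j; apply: h2; exists j.
case: (pselect (forall j, u j = 0)) => [u0|/existsNP[j uj]].
  by exists i0 => j; rewrite !u0.
(* Leading exponents are at least [A], hence of the form [A + k] with [k] natural. A member with the
   least such [k] has the greatest norm. *)
have h : exists k : nat, `[<exists2 i, lcoef (u i) (A + k%:Z) != 0 & vge (u i) (A + k%:Z)>].
  case: (leadP (u j)) => [//|[i [ui hi]]].
  case: (ltP i A) => [/hA|/int_shift[k ek]]; first by move=> e; rewrite e eqxx in ui.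
  by exists k; apply/asboolP; exists j; rewrite -ek.
case: (ex_minnP h) => k /asboolP[i ui hi] kmin; exists i => l.
have [[_ ->]|[n [un hn ->]]] := knormP (u l).
  by case: (knormP (u i)) => [[_ ->]|[n [_ _ ->]]] //; rewrite ltW ?Qpow_gt0.
have -> : knorm (u i) = Q ^ (- (A + k%:Z)).
  apply/le_anti; rewrite (knorm_le _ _).2 //=.
  case: (knormP (u i)) => [[e]|[n' [un' hn' ->]]]; first by rewrite e eqxx in ui.
  rewrite ler_eXz2l ?Q_gt1 // lerN2 leNgt; apply/negP => /hn' e.
  by rewrite e eqxx in ui.
rewrite ler_eXz2l ?Q_gt1 // lerN2.
case: (ltP n A) => [/hA e|/int_shift[k' ek]]; first by rewrite e eqxx in un.
suff : (k <= k')%N by lia.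
by apply: kmin; apply/asboolP; exists l; rewrite -ek.
Qed.

Lemma maxval_knorm_le (I : Type) (i0 : I) (u : I -> K) A N :
  (forall i, vge (u i) A) ->
  maxval (fun r => exists i, r = knorm (u i)) <= Q ^ (- N) <-> (forall i, vge (u i) N).
Proof.
move=> /(maxval_knorm i0)[[j ->] hm]; split=> [h i|h]; last exact/knorm_le.
by apply/knorm_le; apply: le_trans h.
Qed.

(** Norms are 0 or powers of [q], so a maximum is determined by the exponents [N] for which it is at
    most [q^(-N)]. This turns the norm identity of an orthonormal basis into an equivalence between
    valuations. *)
Lemma maxval_knorm_eq (I J : Type) (i0 : I) (j0 : J) (u : I -> K) (v : J -> K) A :
  (forall i, vge (u i) A) -> (forall j, vge (v j) A) ->
  maxval (fun r => exists i, r = knorm (u i)) = maxval (fun r => exists j, r = knorm (v j))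
  <-> (forall N, (forall i, vge (u i) N) <-> (forall j, vge (v j) N)).
Proof.
move=> hu hv; split=> [e N|].
  by rewrite -(maxval_knorm_le i0 N hu) e (maxval_knorm_le j0 N hv).
wlog suff H : I J i0 j0 u v hu hv /
  (forall N, (forall i, vge (u i) N) <-> (forall j, vge (v j) N)) ->
  maxval (fun r => exists j, r = knorm (v j)) <= maxval (fun r => exists i, r = knorm (u i)).
  move=> h; apply/le_anti; rewrite !H // => N; by split=> /h.
move=> h; have [[i ei] hi] := maxval_knorm i0 hu.
case: (knormP (u i)) => [[_ e0]|[n [_ _ en]]]; last first.
  by rewrite ei en; apply/(maxval_knorm_le j0 _ hv)/h/(maxval_knorm_le i0 _ hu); rewrite ei en.
(* The remaining case is a zero maximum: all [u k] vanish, so each [v j] has valuation at least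
   every [n] and vanishes too. *)
have u0 k : u k = 0.
  have := hi k; rewrite ei e0; case: (knormP (u k)) => [[]//|[n [_ _ ->]]].
  by rewrite leNgt Qpow_gt0.
have [[j ->] _] := maxval_knorm j0 hv; rewrite ei e0.
have v0 : v j = 0 by apply: vge_all0 => n; apply: (h n%:Z).1 => k; rewrite u0.
by case: (knormP (v j)) => [[_ ->]//|[n [/eqP]]]; rewrite v0.
Qed.

(** * Continuity of the two families *)

Lemma vcont_sum (I : Type) (r : seq I) (f : I -> O F -> K) :
  (forall i, vcont (f i)) -> vcont (fun t => \sum_(i <- r) f i t).
Proof.
move=> hf t n; elim: r => [|i r [m hm]].
  by exists 0%N => s _; rewrite !big_nil subrr.
have [m' hm'] := hf i t n; exists (maxn m m') => s hs.
rewrite !big_cons opprD addrACA; apply: vgeD; [apply: hm'|apply: hm]; apply: vge_le hs; lia.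
Qed.

Lemma vcontB f g : vcont f -> vcont g -> vcont (fun t => f t - g t).
Proof.
move=> hf hg t n; have [m hm] := hf t n; have [m' hm'] := hg t n.
exists (maxn m m') => s hs.
have -> : f s - g s - (f t - g t) = (f s - f t) - (g s - g t) by ring.
by apply: vgeB; [apply: hm|apply: hm']; apply: vge_le hs; lia.
Qed.

Lemma vcontM f g : vcont f -> vcont g -> vcont (fun t => f t * g t).
Proof.
move=> hf hg t n.
case: (vge_ex (f t)) (vge_ex (g t)) => [A hA] [B hB].
(* The precision compensates for the lower bounds [A] and [B] on the values at [t], and is at least
   [n] so that the product of the two differences is small as well. *)
have [m hm] := hf t (`|n%:Z - B| + n)%N; have [m' hm'] := hg t (`|n%:Z - A| + n)%N.
exists (maxn m m') => s hs.
have -> : f s * g s - f t * g t =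
    (f s - f t) * (g s - g t) + f t * (g s - g t) + (f s - f t) * g t by ring.
have {}hm : vge (f s - f t) (`|n%:Z - B| + n)%N%:Z by apply: hm; apply: vge_le hs; lia.
have {}hm' : vge (g s - g t) (`|n%:Z - A| + n)%N%:Z by apply: hm'; apply: vge_le hs; lia.
apply: vgeD; [apply: vgeD|].
- by apply: vge_le (vgeM hm hm'); lia.
- by apply: vge_le (vgeM hA hm'); lia.
- by apply: vge_le (vgeM hm hB); lia.
Qed.

Lemma vcont_cst x : vcont (fun=> x).
Proof. by move=> t n; exists 0%N => s _; rewrite subrr. Qed.

Lemma vcontX f k : vcont f -> vcont (fun t => f t ^+ k).
Proof.
move=> hf; elim: k => [|k IH]; first exact: vcont_cst.
by under [X in vcont X]eq_fun do rewrite exprS; apply: vcontM.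
Qed.

Lemma vcont_prod (I : Type) (r : seq I) (f : I -> O F -> K) :
  (forall i, vcont (f i)) -> vcont (fun t => \prod_(i <- r) f i t).
Proof.
move=> hf; elim: r => [|i r IH].
  by under [X in vcont X]eq_fun do rewrite big_nil; apply: vcont_cst.
by under [X in vcont X]eq_fun do rewrite big_cons; apply: vcontM.
Qed.

Lemma vcont_val : vcont (fun t => proj1_sig t).
Proof. by move=> t n; exists n. Qed.

Lemma vcont_hasse n : vcont (fun t => hasse n (proj1_sig t)).
Proof.
(* The coefficient of index [i] in the derivative involves the coefficient of index [i + n], whence
   the shift by [n]. *)
move=> t k; exists (k + n)%N => s hs i hi.
rewrite lcoefB /= /hasse_coef -mulrBr -lcoefB hs ?mulr0 //; lia.
Qed.

Lemma vcont_E_car n : vcont (fun t => E_car n (proj1_sig t)).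
Proof.
case: n => [|n]; first exact: vcont_val.
have [u eu _] := F_car_inv F n.+1.
under [X in vcont X]eq_fun => t do rewrite /= (kdiv_inv _ eu) e_carE.
apply: vcontM (vcont_cst _); apply: vcont_prod => c.
exact: vcontB vcont_val (vcont_cst _).
Qed.

Lemma vcont_Gcar j : vcont (@Gcar F j).
Proof.
rewrite (funext (GcarE j)).
by apply: vcont_prod => i; apply/vcontX/vcont_E_car.
Qed.

Lemma vcont_Dder j : vcont (@Dder F j).
Proof.
rewrite (funext (DderE j)).
by apply: vcont_prod => i; apply/vcontX/vcont_hasse.
Qed.

End Analysis.

(** * Orthonormal bases through isometry and density of finite combinations *)

Section Basis.
Variable F : finFieldType.
Local Notation K := (laurent F).
Implicit Types (x y z : K) (N A B : int) (fs gs : nat -> O F -> K) (f : O F -> K).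
(** This is the inequality bounding the coefficients by the sup-norm of the combination; the
    opposite one follows when the functions take integral values. *)
Definition fin_isometric fs : Prop := forall (M : nat) (b : nat -> K) (N : int),
  (forall t, vge (\sum_(k < M) b k * fs k t) N) -> forall k, (k < M)%N -> vge (b k) N.

Definition fin_dense fs : Prop := forall f, vcont f -> forall n : nat,
  exists (M : nat) (b : nat -> K), forall t, vge (f t - \sum_(k < M) b k * fs k t) n%:Z.

Lemma vge_fin M (b : nat -> K) : exists A, forall k, (k < M)%N -> vge (b k) A.
Proof.
elim: M => [|M [A hA]]; first by exists 0.
case: (vge_ex (b M)) => B hB; exists (Num.min A B) => k.
by rewrite ltnS leq_eqVlt => /orP[/eqP->|/hA h]; [apply: vge_le hB|apply: vge_le h]; lia.
Qed.

Lemma vnull_bounded (a : nat -> K) : vnull a -> exists A, forall k, vge (a k) A.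
Proof.
move=> /(_ 0%N)[M hM]; have [A hA] := vge_fin M a; exists (Num.min A 0) => k.
by case: (ltnP k M) => [/hA|/hM] h; apply: vge_le h; lia.
Qed.

Lemma O_point : O F.
Proof. by exists (kzero F). Qed.

(** The last clause encodes the identity between the sup-norm of [f] and the maximum of the norms of
    the [a k]. *)
Definition vexpansion fs f (a : nat -> K) : Prop :=
  [/\ vnull a, vseries a fs f,
      forall b, vnull b -> vseries b fs f -> b = a &
      forall N, (forall t, vge (f t) N) <-> (forall k, vge (a k) N)].

(** A partial sum at precision 0 leaves an integral remainder, whence the minimum with 0.
    Boundedness of [f] is thus obtained from its expansion instead of the compactness of [O]. *)
Lemma vseries_bounded fs f a A : (forall n t, vge (fs n t) 0) ->
  (forall k, vge (a k) A) -> vseries a fs f -> forall t, vge (f t) (Num.min A 0).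
Proof.
move=> fs0 hA /(_ 0%N)[M /(_ M (leqnn M)) hM] t.
rewrite -[f t](subrK (\sum_(k < M) a k * fs k t)); apply: vgeD.
  by apply: vge_le (hM t); lia.
by apply: vge_sum => k _; apply: vgeMl => //; apply: vge_le (hA k); lia.
Qed.

(** Integrality of the [fs n] bounds the values of [f] as well as the coefficients, as the
    comparison of maxima requires. *)
Lemma is_onbP fs : (forall n t, vge (fs n t) 0) ->
  is_onb fs <-> (forall n, vcont (fs n)) /\
                (forall f, vcont f -> exists a, vexpansion fs f a).
Proof.
move=> fs0.
have max_eq f a : vnull a -> vseries a fs f ->
    supnorm f = maxval (fun r => exists n, r = knorm (a n)) <->
    (forall N, (forall t, vge (f t) N) <-> (forall k, vge (a k) N)).
  move=> ha hs; have [A hA] := vnull_bounded ha.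
  apply: (maxval_knorm_eq O_point 0%N (A := Num.min A 0)).
    exact: vseries_bounded hs.
  by move=> k; apply: vge_le (hA k); lia.
split=> -[hc he]; (split=> [n|f hf]; first exact/kcontP).
  have [a [[/knullP ha /kseriesP hs] [hu hn]]] := he f ((kcontP f).2 hf).
  exists a; split=> //; last exact/max_eq.
  by move=> b hb hsb; apply: hu; [apply/knullP|apply/kseriesP].
have [a [ha hs hu hn]] := he f ((kcontP f).1 hf).
exists a; split; first by split; [apply/knullP|apply/kseriesP].
split; last exact/max_eq.
by move=> b /knullP hb /kseriesP hsb; apply: hu.
Qed.

Lemma vcont_comb fs M (b : nat -> K) : (forall n, vcont (fs n)) ->
  vcont (fun t => \sum_(k < M) b k * fs k t).
Proof.
move=> hc; apply: (@vcont_sum F _ _ (fun (k : 'I_M) t => b k * fs k t)) => k.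
exact: vcontM (vcont_cst _) (hc k).
Qed.

(** Extension by zero makes a finite combination a series, and lets combinations of different
    lengths be compared over a common range. *)
Definition pad M (b : nat -> K) (k : nat) : K := if (k < M)%N then b k else 0.

Lemma comb_pad M L (b : nat -> K) fs t : (M <= L)%N ->
  \sum_(k < L) pad M b k * fs k t = \sum_(k < M) b k * fs k t.
Proof.
move=> h; rewrite -(subnKC h) big_split_ord /= [X in _ + X]big1 ?addr0.
  by apply: eq_bigr => i _; rewrite /pad ltn_ord.
by move=> i _; rewrite /pad ltnNge leq_addr mul0r.
Qed.

Section FromExpansion.
Variable fs : nat -> O F -> K.
Hypothesis fs0 : forall n t, vge (fs n t) 0.
Hypothesis fsc : forall n, vcont (fs n).

Section Forward.
Hypothesis fse : forall f, vcont f -> exists a, vexpansion fs f a.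

(** By uniqueness, the expansion of a finite combination is its own zero-padded coefficient
    sequence, to which the norm clause applies. *)
Lemma fin_isometric_expansion : fin_isometric fs.
Proof.
move=> M b N hN k hk.
have hs : vseries (pad M b) fs (fun t => \sum_(k < M) b k * fs k t).
  by move=> n; exists M => L leML t; rewrite comb_pad // subrr.
have hb : vnull (pad M b) by move=> n; exists M => i hi; rewrite /pad ltnNge hi.
have [a [_ _ ha hiff]] := fse (vcont_comb M b fsc).
have : vge (pad M b k) N by rewrite (ha _ hb hs); exact: (hiff N).1.
by rewrite /pad hk.
Qed.

End Forward.

Section Backward.
Hypothesis fsi : fin_isometric fs.
Hypothesis fsd : fin_dense fs.

(** Approximations of [f] to precision [n] have coefficients that are Cauchy in [n] by isometry;
    their limits are the coefficients of the expansion. *)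
Lemma expansion_of_dense f : vcont f -> exists a, vexpansion fs f a.
Proof.
move=> hf.
have [Mb hMb] : exists Mb : nat -> nat * (nat -> K),
    forall n t, vge (f t - \sum_(k < (Mb n).1) (Mb n).2 k * fs k t) n%:Z.
  suff /choice[Mb hMb] : forall n : nat, exists Mb : nat * (nat -> K),
      forall t, vge (f t - \sum_(k < Mb.1) Mb.2 k * fs k t) n%:Z by exists Mb.
  move=> n.
  by have [M [b h]] := fsd hf n; exists (M, b).
pose M n := (Mb n).1; pose b n := pad (M n) (Mb n).2.
have hb n L t : (M n <= L)%N -> vge (f t - \sum_(k < L) b n k * fs k t) n%:Z.
  by move=> h; rewrite comb_pad //; apply: hMb.
(* Two combinations approximating [f] to the same precision have coefficients agreeing to that
   precision. *)
have iso L (c d : nat -> K) N : (forall t, vge (f t - \sum_(k < L) c k * fs k t) N) ->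
    (forall t, vge (f t - \sum_(k < L) d k * fs k t) N) ->
    forall k, (k < L)%N -> vge (d k - c k) N.
  move=> hc hd; apply: (fsi (b := fun k => d k - c k)) => t.
  under eq_bigr do rewrite mulrBl.
  rewrite sumrB; set s := \sum_(i < L) d i * _; set s' := \sum_(i < L) _.
  have -> : s - s' = (f t - s') - (f t - s) by ring.
  exact: vgeB.
have [a ha] : exists a : nat -> K, forall k n, vge (a k - b n k) n%:Z.
  suff /choice[a ha] : forall k, exists a : K, forall n, vge (a - b n k) n%:Z by exists a.
  move=> k; apply: laurent_lim => m n lemn.
  apply: (iso (maxn k.+1 (maxn (M m) (M n)))) => [t|t|]; last by lia.
    by apply: hb; lia.
  by apply: vge_le (hb n _ t _); lia.
have sa : vseries a fs f.
  move=> n; exists (M n) => L hL t; set s := \sum_(k < L) _.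
  have -> : f t - s = (f t - \sum_(k < L) b n k * fs k t)
      - \sum_(k < L) (a k - b n k) * fs k t.
    under [X in _ = _ - X]eq_bigr do rewrite mulrBl.
    by rewrite sumrB -/s; ring.
  by apply: vgeB; [exact: hb|apply: vge_sum => k _; apply: vgeMl].
exists a; split=> //.
(* Beyond [M n] the padded [b n k] is 0, and [a k] agrees with it to precision [n]. *)
- move=> n; exists (M n) => k hk; have := ha k n.
  by rewrite /b /pad ltnNge hk subr0.
- move=> c _ sc; apply: funext => k; apply/eqP; rewrite -subr_eq0; apply/eqP.
  apply: vge_all0 => n; have [L1 h1] := sa n; have [L2 h2] := sc n.
  by apply: (iso (maxn k.+1 (maxn L1 L2))) => [t|t|]; [apply: h1|apply: h2|]; lia.
- move=> N; split=> h => [k|t].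
    (* As [|N| >= N], the bound on [f] passes to a partial sum, taken long enough to include index
       [k]. *)
    have [L hL] := sa `|N|%N; apply: (fsi (M := maxn k.+1 L)) => [t|]; last by lia.
    set s := \sum_(_ < _) _; have -> : s = f t - (f t - s) by ring.
    apply: vgeB => //; have h' : (L <= maxn k.+1 L)%N by lia.
    by apply: vge_le (hL _ h' t); lia.
  have [L hL] := sa `|N|%N; rewrite -[f t](subrK (\sum_(k < L) a k * fs k t)).
  apply: vgeD; first by apply: vge_le (hL _ (leqnn L) t); lia.
  by apply: vge_sum => k _; apply: vgeMl.
Qed.

End Backward.
End FromExpansion.

Lemma comb_congr M (b : nat -> K) fs gs N t :
  (forall n t, vge (fs n t - gs n t) 1) -> (forall k, (k < M)%N -> vge (b k) N) ->
  vge (\sum_(k < M) b k * fs k t - \sum_(k < M) b k * gs k t) (N + 1).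
Proof.
move=> fg hb; rewrite -sumrB; apply: vge_sum => k _.
by rewrite -mulrBr; apply: vgeM => //; apply: hb.
Qed.

(** * Stability under perturbations divisible by [T] *)

Section Perturbation.
Variables fs gs : nat -> O F -> K.
Hypothesis fs0 : forall n t, vge (fs n t) 0.
Hypothesis gsc : forall n, vcont (gs n).
Hypothesis fg : forall n t, vge (fs n t - gs n t) 1.

(* If all b_k have valuation at least j, then sum b_k f_k and sum b_k g_k agree
   modulo T^(j+1); the isometry property of (f_k) thus raises j up to N. *)
Lemma fin_isometric_congr : fin_isometric fs -> fin_isometric gs.
Proof.
move=> fsi M b N hN; have [A hA] := vge_fin M b.
suff H (j : nat) k : (k < M)%N -> vge (b k) (Num.min N (A + j%:Z)).
  (* After [|N - A|] rounds the bound [A + j] has reached [N], where the minimum caps it. *)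
  by move=> k /(H `|N - A|%N); apply: vge_le; lia.
elim: j k => [|j IH] k hk; first by apply: vge_le (hA k hk); lia.
apply: (fsi M) => // t; set s := \sum_(_ < M) _.
rewrite -[s](subrK (\sum_(k < M) b k * gs k t)); apply: vgeD.
  by apply: vge_le (comb_congr t fg IH); lia.
by apply: vge_le (hN t); lia.
Qed.

(* Successive approximation: expanding the remainder in (f_k) and replacing f_k
   by g_k gains one power of T. *)
Lemma fin_dense_congr :
  (forall f, vcont f -> exists a, vexpansion fs f a) -> fin_dense gs.
Proof.
move=> fse f hf n; have [A hA] : exists A, forall t, vge (f t) A.
  have [a [/vnull_bounded[A hA] hs _ _]] := fse f hf.
  by exists (Num.min A 0); apply: vseries_bounded hs.
suff H (j : nat) : exists M (b : nat -> K), forall t,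
    vge (f t - \sum_(k < M) b k * gs k t) (A + j%:Z).
  have [M [b h]] := H `|n%:Z - A|%N; exists M, b => t.
  by apply: vge_le (h t); lia.
elim: j => [|j [M [b hb]]].
  by exists 0%N, (fun=> 0) => t; rewrite big_ord0 subr0 addr0.
have hr := vcontB hf (vcont_comb M b gsc).
(* The norm clause transfers the valuation bound [A + j] from the remainder to all its
   coefficients. *)
have [a [_ hs _ /(_ (A + j%:Z))[/(_ hb) ha _]]] := fse _ hr.
have [L hL] := hs `|(A + j%:Z + 1)%R|%N; pose P := maxn L M.
have hMP : (M <= P)%N by rewrite /P; lia.
exists P, (fun k => pad M b k + a k) => t.
under eq_bigr do rewrite mulrDl.
rewrite big_split comb_pad //; set s := \sum_(i < M) _; set sg := \sum_(i < P) _.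
pose sf := \sum_(k < P) a k * fs k t.
(* The first difference is the tail of the expansion of the remainder, small by the choice of [L];
   the second gains a power of [T] from the congruence of the two families. *)
have -> : f t - (s + sg) = (f t - s - sf) + (sf - sg) by ring.
have h : (L <= P)%N by rewrite /P; lia.
apply: vgeD; first by apply: vge_le (hL _ h t); lia.
by apply: vge_le (comb_congr t fg (fun k _ => ha k)); lia.
Qed.

End Perturbation.

Lemma is_onb_congr fs gs :
  (forall n t, vge (fs n t) 0) -> (forall n t, vge (gs n t) 0) ->
  (forall n, vcont (gs n)) -> (forall n t, vge (fs n t - gs n t) 1) ->
  is_onb fs -> is_onb gs.
Proof.
move=> fs0 gs0 gsc fg /(is_onbP fs0)[fsc fse]; apply/(is_onbP gs0); split=> //.
apply: expansion_of_dense => //; last exact: fin_dense_congr fse.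
by apply: fin_isometric_congr fg _; apply: fin_isometric_expansion.
Qed.

End Basis.

Theorem theorem6 (F : finFieldType) :
  is_onb (@Gcar F) <-> is_onb (@Dder F).
Proof.
have G0 n t : vge (@Gcar F n t) 0 by have [c [[]]] := Gcar_Dder_res n t.
have D0 n t : vge (@Dder F n t) 0 by have [c [_ []]] := Gcar_Dder_res n t.
have GD n t : vge (@Gcar F n t - Dder n t) 1.
  by have [c [hG hD]] := Gcar_Dder_res n t; apply: res_vge1B hG hD.
split; apply: is_onb_congr => //; [exact: vcont_Dder|exact: vcont_Gcar|].
by move=> n t; apply: vgeBC.
Qed.
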